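(* For every set $\Gamma\cup\{\varphi\}\subseteq\mathcal{L}_0$ of formulas, $\Gamma\vdash_{H_0}\varphi$ if and only if $\Gamma\models\varphi$, where $\models$ is local semantic consequence over static network models.
   Context: Fix a positive integer $m$ and $G=\{0,\frac1m,\frac2m,\ldots,1\}$; for $r,s\in G$ let $r\oplus s=\min\{1,r+s\}$. Let $A$ be a finite nonempty set of agents, $P$ a nonempty (possibly infinite) set of propositional atoms, and $\Omega$ a finite set of nominals with $P\cap\Omega=\varnothing$ and $|\Omega|=|A|$. Static network model: a tuple $M=(A,(\sim_r)_{r\in G},V)$ where $V:P\cup\Omega\to\wp(A)$ is such that each $V(i)$, $i\in\Omega$, is a singleton and the map sending $i$ to the unique member of $V(i)$ is a bijection $\Omega\to A$; and each $\sim_r\subseteq A\times A$, with, for all $a,b,c\in A$, $r,s\in G$: $a\sim_r a$; $a\sim_r b\Leftrightarrow b\sim_r a$; $a\sim_1 b$; $a\sim_r b\Rightarrow a\sim_s b$ if $r\le s$; $a\sim_r b$ and $b\sim_s c$ imply $a\sim_{r\oplus s}c$. Language $\mathcal{L}_0$: $\varphi::=p\mid i\mid\neg\varphi\mid(\varphi\land\psi)\mid\langle r\rangle\varphi\mid @_i\varphi$ with $p\in P$, $i\in\Omega$, $r\in G$. Other Boolean connectives and $\top,\bot$ are defined as usual; $[r]\varphi:=\neg\langle r\rangle\neg\varphi$. Semantics at $a\in A$: $M,a\models p$ iff $a\in V(p)$; $M,a\models i$ iff $a\in V(i)$; Boolean clauses as usual; $M,a\models\langle r\rangle\varphi$ iff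 $M,b\models\varphi$ for some $b\in A$ with $a\sim_r b$; $M,a\models @_i\varphi$ iff $M,b\models\varphi$ where $V(i)=\{b\}$. $\Gamma\models\varphi$ iff for every static network model $M$ and every agent $a$ of $M$, if $M,a\models\gamma$ for all $\gamma\in\Gamma$ then $M,a\models\varphi$. System $H_0$: all propositional tautologies (instances in $\mathcal{L}_0$); the following axiom schemes for all $r,s\in G$, $i,j\in\Omega$ and all formulas $\varphi,\psi$: $(T_r)$ $[r]\varphi\to\varphi$; $(B_r)$ $\varphi\to[r]\langle r\rangle\varphi$; (Mon) $[s]\varphi\to[r]\varphi$ for $r\le s$; (Tri) $[r\oplus s]\varphi\to[r][s]\varphi$; (Bd) $@_i\langle1\rangle j$; (Name) $\bigvee_{i\in\Omega}i$; $(\mathrm{Paste}_r)$ $@_i\langle r\rangle\varphi\leftrightarrow\bigvee_{j\in\Omega}(@_i\langle r\rangle j\land @_j\varphi)$; $(K_@)$ $@_i(\varphi\to\psi)\to(@_i\varphi\to@_i\psi)$; (Self) $\neg@_i\varphi\leftrightarrow@_i\neg\varphi$; $(\mathrm{Ref}_@)$ $@_ii$; (Agree) $@_i@_j\varphi\leftrightarrow@_j\varphi$; $(\mathrm{Conj}_@)$ $@_i(\varphi\land\psi)\leftrightarrow(@_i\varphi\land@_i\psi)$; (Locality) $i\to(\varphi\leftrightarrow@_i\varphi)$; (Dist) $@_i\neg j$ for $i\ne j$. Rules: modus ponens; replacement (from $\vdash\varphi\leftrightarrow\psi$ infer $\vdash C[\varphi]\leftrightarrow C[\psi]$ for any one-place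 formula context $C[\cdot]$); necessitation for each $r\in G$ (from $\vdash\varphi$ infer $\vdash[r]\varphi$); and $(\mathrm{Gen}_@)$ (from $\vdash\varphi$ infer $\vdash@_i\varphi$). $\Gamma\vdash_{H_0}\varphi$ means that $\varphi$ is derivable from members of $\Gamma$ and theorems of $H_0$ by modus ponens; replacement, necessitation and $(\mathrm{Gen}_@)$ apply only to theorems. *)

(* Defs.v *)
From HB Require Import structures.
From mathcomp Require Import all_boot all_order all_algebra.

Set Implicit Arguments.
Unset Strict Implicit.
Unset Printing Implicit Defensive.

Import Order.TTheory GRing.Theory Num.Theory.

Definition in_grid (m : nat) (q : rat) : bool :=
  [exists k : 'I_m.+1, q == (k%:R / m%:R)%R].

Record grid (m : nat) := Grid { gval :> rat; _ : in_grid m gval }.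

HB.instance Definition _ (m : nat) := [isSub of grid m for @gval m].
HB.instance Definition _ (m : nat) := [Choice of grid m by <:].

Lemma in_grid1 (m : nat) : 0 < m -> in_grid m 1%R.
Proof.
move=> m_gt0; apply/existsP; exists ord_max => /=.
by rewrite divff // pnatr_eq0 -lt0n.
Qed.

Lemma in_gridD (m : nat) (r s : grid m) :
  in_grid m (Num.min 1 (gval r + gval s))%R.
Proof.
case: r => r /= /existsP[k /eqP ->]; case: s => s /= /existsP[l /eqP ->].
rewrite -mulrDl -natrD; case: (posnP m) => [m0|m_gt0].
  apply/existsP; exists ord0; rewrite mul0r.
  by rewrite (_ : m%:R = 0)%R ?m0 // invr0 mulr0.
have m_gt0R : (0 < m%:R :> rat)%R by rewrite ltr0n.
case: (leqP (k + l) m) => [le_m|lt_m].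
  apply/existsP; exists (Ordinal (le_m : k + l < m.+1)) => /=; apply/eqP.
  by apply: min_r; rewrite ler_pdivrMr // mul1r ler_nat.
suff -> : Num.min 1%R ((k + l)%:R / m%:R)%R = 1%R :> rat by exact: in_grid1.
by apply: min_l; rewrite ler_pdivlMr // mul1r ler_nat ltnW.
Qed.

Definition gone (m : nat) (m_gt0 : 0 < m) : grid m := Grid (in_grid1 m_gt0).

Definition oplus (m : nat) (r s : grid m) : grid m := Grid (in_gridD r s).

(* Atoms and nominals come from two types, hence are disjoint. *)
Inductive fml (m : nat) (P : Type) (Omega : finType) : Type :=
| Atom of P
| Nom of Omega
| Neg of fml m P Omega
| And of fml m P Omega & fml m P Omega
| Dia of grid m & fml m P Omega
| At of Omega & fml m P Omega.

Arguments Atom {m P Omega}.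
Arguments Nom {m P Omega}.

Section Connectives.
Variables (m : nat) (P : Type) (Omega : finType).
Local Notation fml := (fml m P Omega).

Definition Or (f g : fml) : fml := Neg (And (Neg f) (Neg g)).
Definition Imp (f g : fml) : fml := Neg (And f (Neg g)).
Definition Iff (f g : fml) : fml := And (Imp f g) (Imp g f).
Definition Box (r : grid m) (f : fml) : fml := Neg (Dia r (Neg f)).

(* The language has no primitive constant, so falsum is taken to be a
   contradiction on a chosen atom p0 (the set of atoms is nonempty). *)
Definition Bot (p0 : P) : fml := And (Atom p0) (Neg (Atom p0)).

(* The disjunction over the enumeration of Omega, ending with Bot p0. *)
Definition BigOr (p0 : P) (F : Omega -> fml) : fml :=
  \big[Or/Bot p0]_(i : Omega) F i.

End Connectives.

Record network (m : nat) (m_gt0 : 0 < m) (P : Type) (Omega A : finType) :=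
  Network {
  sim : grid m -> rel A;
  valuation : P + Omega -> {set A};
  valuation_nominal : exists h : Omega -> A,
    bijective h /\ forall i, valuation (inr i) = [set h i];
  sim_refl : forall r a, sim r a a;
  sim_sym : forall r a b, sim r a b <-> sim r b a;
  sim_one : forall a b, sim (gone m_gt0) a b;
  sim_mono : forall (r s : grid m) a b,
    (gval r <= gval s)%R -> sim r a b -> sim s a b;
  sim_tri : forall r s a b c, sim r a b -> sim s b c -> sim (oplus r s) a c
}.

Fixpoint sat (m : nat) (m_gt0 : 0 < m) (P : Type) (Omega A : finType)
    (M : network m_gt0 P Omega A) (f : fml m P Omega) (a : A) {struct f}
    : bool :=
  match f with
  | Atom p => a \in valuation M (inl p)
  | Nom i => a \in valuation M (inr i)
  | Neg g => ~~ sat M g a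
  | And g h => sat M g a && sat M h a
  | Dia r g => [exists b, sim M r a b && sat M g b]
  | At i g => [exists b, (valuation M (inr i) == [set b]) && sat M g b]
  end.

Definition entails (m : nat) (m_gt0 : 0 < m) (P : Type) (Omega A : finType)
    (Gamma : fml m P Omega -> Prop) (f : fml m P Omega) : Prop :=
  forall (M : network m_gt0 P Omega A) (a : A),
    (forall g, Gamma g -> sat M g a) -> sat M f a.

(* Propositional formulas, used to define substitution instances of
   tautologies. *)
Inductive pfml : Type :=
| PVar of nat
| PNeg of pfml
| PAnd of pfml & pfml.

Fixpoint peval (v : nat -> bool) (t : pfml) : bool :=
  match t with
  | PVar n => v n
  | PNeg t1 => ~~ peval v t1
  | PAnd t1 t2 => peval v t1 && peval v t2
  end.

Definition tautology (t : pfml) : Prop := forall v, peval v t.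

Section System.
Variables (m : nat) (m_gt0 : 0 < m) (P : Type) (p0 : P) (Omega : finType).
Local Notation fml := (fml m P Omega).

Fixpoint psubst (sigma : nat -> fml) (t : pfml) : fml :=
  match t with
  | PVar n => sigma n
  | PNeg t1 => Neg (psubst sigma t1)
  | PAnd t1 t2 => And (psubst sigma t1) (psubst sigma t2)
  end.

Inductive H0_axiom : fml -> Prop :=
| AxTaut t sigma : tautology t -> H0_axiom (psubst sigma t)
| AxT r f : H0_axiom (Imp (Box r f) f)
| AxB r f : H0_axiom (Imp f (Box r (Dia r f)))
| AxMon (r s : grid m) f :
    (gval r <= gval s)%R -> H0_axiom (Imp (Box s f) (Box r f))
| AxTri r s f : H0_axiom (Imp (Box (oplus r s) f) (Box r (Box s f)))
| AxBd i j : H0_axiom (At i (Dia (gone m_gt0) (Nom j)))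
| AxName : H0_axiom (BigOr p0 (fun i => Nom i))
| AxPaste r i f :
    H0_axiom (Iff (At i (Dia r f))
               (BigOr p0 (fun j => And (At i (Dia r (Nom j))) (At j f))))
| AxKAt i f g : H0_axiom (Imp (At i (Imp f g)) (Imp (At i f) (At i g)))
| AxSelf i f : H0_axiom (Iff (Neg (At i f)) (At i (Neg f)))
| AxRefAt i : H0_axiom (At i (Nom i))
| AxAgree i j f : H0_axiom (Iff (At i (At j f)) (At j f))
| AxConjAt i f g : H0_axiom (Iff (At i (And f g)) (And (At i f) (At i g)))
| AxLocality i f : H0_axiom (Imp (Nom i) (Iff f (At i f)))
| AxDist i j : i <> j -> H0_axiom (At i (Neg (Nom j))).

(* Formula contexts with exactly one occurrence of the hole. *)
Inductive ctx : Type :=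
| CHole
| CNeg of ctx
| CAndL of ctx & fml
| CAndR of fml & ctx
| CDia of grid m & ctx
| CAt of Omega & ctx.

Fixpoint fill (C : ctx) (f : fml) : fml :=
  match C with
  | CHole => f
  | CNeg D => Neg (fill D f)
  | CAndL D g => And (fill D f) g
  | CAndR g D => And g (fill D f)
  | CDia r D => Dia r (fill D f)
  | CAt i D => At i (fill D f)
  end.

Inductive H0_thm : fml -> Prop :=
| ThmAx f : H0_axiom f -> H0_thm f
| ThmMP f g : H0_thm (Imp f g) -> H0_thm f -> H0_thm g
| ThmRepl C f g : H0_thm (Iff f g) -> H0_thm (Iff (fill C f) (fill C g))
| ThmNec r f : H0_thm f -> H0_thm (Box r f)
| ThmGen i f : H0_thm f -> H0_thm (At i f).

Inductive H0_derives (Gamma : fml -> Prop) : fml -> Prop :=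
| DerHyp f : Gamma f -> H0_derives Gamma f
| DerThm f : H0_thm f -> H0_derives Gamma f
| DerMP f g :
    H0_derives Gamma (Imp f g) -> H0_derives Gamma f -> H0_derives Gamma g.

End System.

(* Main.v *)
(** Soundness is a check of each axiom and rule.  For completeness, if [phi] is
    not derivable from [Gamma], Zorn's lemma extends [Gamma] to a set maximal
    among those not deriving [phi]; its consequences form a complete theory [D].
    For every nominal [i], [fun f => D (At i f)] is again a complete theory, by
    (Self), (Conj_@) and (Gen_@), and (Paste) reduces diamonds to diamonds of
    nominals.  Identifying agents with nominals by a bijection, [D] defines a
    network relating [i] to [j] by [r] when [D (At i (Dia r (Nom j)))], in which [f] holds at [i]
    iff [D (At i f)].  By (Name) some nominal belongs to [D], and by (Locality)
    that agent satisfies exactly [D]. *)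
Require Import Defs.
From mathcomp Require Import all_boot all_order all_algebra.
From mathcomp Require Import boolp classical_sets.

Set Implicit Arguments.
Unset Strict Implicit.
Unset Printing Implicit Defensive.

(** * Sets of formulas respecting the Boolean connectives *)

Section BooleanTheories.
Variables (m : nat) (P : Type) (p0 : P) (Omega : finType).
Local Notation fml := (fml m P Omega).

(** Shared by the formulas true at an agent and the sets from Zorn's lemma, so that derived
    connectives are treated once for both. *)
Record boolean_theory (D : fml -> Prop) : Prop := BooleanTheory {
  theory_Neg : forall f, D (Neg f) <-> ~ D f;
  theory_And : forall f g, D (And f g) <-> D f /\ D g
}.

Variable D : fml -> Prop.
Hypothesis D_bool : boolean_theory D.

Lemma theory_Imp f g : D (Imp f g) <-> (D f -> D g).
Proof.
rewrite /Imp (theory_Neg D_bool) (theory_And D_bool) (theory_Neg D_bool).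
split=> [nfg Df | fg [/fg //]].
by apply: contrapT => nDg; apply: nfg.
Qed.

Lemma theory_Iff f g : D (Iff f g) <-> (D f <-> D g).
Proof. by rewrite /Iff (theory_And D_bool) !theory_Imp. Qed.

Lemma theory_Or f g : D (Or f g) <-> D f \/ D g.
Proof.
rewrite /Or (theory_Neg D_bool) (theory_And D_bool) !(theory_Neg D_bool).
split=> [nfg | [Df | Dg] [nf ng] //].
by apply: contrapT => nDfg; apply: nfg; split=> ?; apply: nDfg; [left|right].
Qed.

Lemma theory_BigOr (F : Omega -> fml) :
  D (BigOr p0 F) <-> exists i, D (F i).
Proof.
rewrite /BigOr; suff -> (s : seq Omega) :
    D (\big[@Or m P Omega/Bot m Omega p0]_(i <- s) F i)
      <-> exists2 i, i \in s & D (F i).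
  by split=> [[i _ Di] | [i Di]]; exists i; rewrite ?mem_index_enum.
elim: s => [|j s IHs].
  (* The empty disjunction is [Bot p0], a contradiction and so never in [D]. *)
  rewrite big_nil (theory_And D_bool) (theory_Neg D_bool).
  by split=> [[] | [i]].
rewrite big_cons theory_Or IHs; split=> [[Dj | [i i_s Di]] | [i]].
- by exists j; rewrite ?mem_head.
- by exists i; rewrite // inE i_s orbT.
- by rewrite inE => /orP[/eqP -> | i_s] Di; [left | right; exists i].
Qed.

(** Membership in [D] serves as the valuation of the propositional variables. *)
Lemma theory_psubst (sigma : nat -> fml) t :
  D (psubst sigma t) <-> peval (fun n => `[< D (sigma n) >]) t.
Proof.
elim: t => [n|t IHt|t IHt u IHu] /=; first by split=> /asboolP.
- by rewrite (theory_Neg D_bool) IHt; split=> /negP.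
- by rewrite (theory_And D_bool) IHt IHu; split=> /andP.
Qed.

Lemma theory_tautology (sigma : nat -> fml) t :
  tautology t -> D (psubst sigma t).
Proof. by move=> taut; apply/theory_psubst. Qed.

End BooleanTheories.

(** * Soundness of the axioms and rules *)

Section Soundness.
Variables (m : nat) (m_gt0 : 0 < m) (P : Type) (p0 : P) (Omega A : finType).
Local Notation fml := (fml m P Omega).
Variable M : network m_gt0 P Omega A.

Lemma sat_boolean_theory a : boolean_theory (fun f => sat M f a).
Proof.
by split=> [f | f g] /=; [split=> /negP | split=> /andP].
Qed.

Lemma sat_Dia r f a :
  sat M (Dia r f) a <-> exists b, sim M r a b /\ sat M f b.
Proof.
by split=> [/existsP[b /andP[]] | [b [ab fb]]]; last (apply/existsP);
  exists b => //; apply/andP.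
Qed.

Lemma sat_Box r f a :
  sat M (Box r f) a <-> forall b, sim M r a b -> sat M f b.
Proof.
rewrite (theory_Neg (sat_boolean_theory a)) sat_Dia; split=> [nab b ab | all_f].
  by apply: contrapT => /negP nfb; apply: nab; exists b.
by case=> b [/all_f fb /negP].
Qed.

Variable h : Omega -> A.
Hypotheses (h_bij : bijective h)
           (h_val : forall i, valuation M (inr i) = [set h i]).

Lemma sat_Nom i a : sat M (Nom i) a <-> a = h i.
Proof. by rewrite /= h_val inE; split=> /eqP. Qed.

Lemma sat_At i f a : sat M (At i f) a <-> sat M f (h i).
Proof.
rewrite /= h_val; split=> [/existsP[b /andP[/eqP/set1_inj -> //]] | fi].
by apply/existsP; exists (h i); rewrite eqxx.
Qed.

(** Besides the network conditions, surjectivity of [h] gives (Name) and one half of (Paste), and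
    its injectivity gives (Dist). *)
Lemma axiom_sound f : H0_axiom m_gt0 p0 f -> forall a, sat M f a.
Proof.
move=> ax a; have Ba := sat_boolean_theory a.
have [g hK gK] := h_bij.
case: {f} ax => [t sigma|r f|r f|r s f rs|r s f|i j||r i f|i f1 f2|i f|i
                |i j f|i f1 f2|i f|i j ij].
- exact: (theory_tautology Ba).
- by apply/(theory_Imp Ba) => /sat_Box; apply; apply: sim_refl.
- apply/(theory_Imp Ba) => fa; apply/sat_Box => b ab; apply/sat_Dia.
  by exists a; split=> //; apply/sim_sym.
- apply/(theory_Imp Ba) => /sat_Box fs; apply/sat_Box => b ab.
  exact/fs/(sim_mono rs).
- apply/(theory_Imp Ba) => /sat_Box frs.
  apply/sat_Box => b ab; apply/sat_Box => c bc.
  exact/frs/(sim_tri ab).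
- apply/sat_At/sat_Dia; exists (h j); split; first exact: sim_one.
  exact/sat_Nom.
- by apply/(theory_BigOr p0 Ba); exists (g a); apply/sat_Nom.
- apply/(theory_Iff Ba); rewrite sat_At sat_Dia (theory_BigOr p0 Ba).
  split=> [[b [ib fb]] | [j /(theory_And Ba)]].
    exists (g b); apply/(theory_And Ba); rewrite !sat_At gK sat_Dia.
    by split=> //; exists b; split=> //; apply/sat_Nom.
  rewrite !sat_At sat_Dia => -[[b [ib /sat_Nom bE]] fj].
  by exists b; rewrite bE in ib *.
- apply/(theory_Imp Ba); rewrite sat_At => fg.
  apply/(theory_Imp Ba); rewrite !sat_At.
  exact: (theory_Imp (sat_boolean_theory (h i)) f1 f2).1.
- apply/(theory_Iff Ba).
  by rewrite (theory_Neg Ba) !sat_At (theory_Neg (sat_boolean_theory (h i))).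
- exact/sat_At/sat_Nom.
- by apply/(theory_Iff Ba); rewrite !sat_At.
- apply/(theory_Iff Ba).
  by rewrite (theory_And Ba) !sat_At (theory_And (sat_boolean_theory (h i))).
- apply/(theory_Imp Ba) => /sat_Nom ->.
  by apply/(theory_Iff (sat_boolean_theory (h i))); rewrite sat_At.
- apply/sat_At/(theory_Neg (sat_boolean_theory (h i))) => /sat_Nom.
  by move/(can_inj hK).
Qed.

(** Agreement is assumed at all agents, since diamonds and [At] evaluate the hole elsewhere. *)
Lemma sat_fill C f g :
  sat M f =1 sat M g -> sat M (fill C f) =1 sat M (fill C g).
Proof.
move=> fg; elim: C => [|C IHC|C IHC k|k C IHC|r C IHC|i C IHC] a //=.
- by rewrite IHC.
- by rewrite IHC.
- by rewrite IHC.
- by apply: eq_existsb => b; rewrite IHC.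
- by apply: eq_existsb => b; rewrite IHC.
Qed.

Lemma thm_sound f : H0_thm m_gt0 p0 f -> forall a, sat M f a.
Proof.
elim=> {f} [f|f g _ IHfg _ IHf|C f g _ IHfg|r f _ IHf|i f _ IHf] a.
- by move=> ax; apply: axiom_sound.
- exact: (theory_Imp (sat_boolean_theory a) f g).1 (IHfg a) (IHf a).
- apply/(theory_Iff (sat_boolean_theory a)).
  rewrite (@sat_fill C f g) // => b; apply/idP/idP.
    by case: ((theory_Iff (sat_boolean_theory b) f g).1 (IHfg b)).
  by case: ((theory_Iff (sat_boolean_theory b) f g).1 (IHfg b)).
- exact/sat_Box.
- exact/sat_At.
Qed.

End Soundness.

Lemma soundness (m : nat) (m_gt0 : 0 < m) (P : Type) (p0 : P)
    (Omega A : finType) (Gamma : fml m P Omega -> Prop) (phi : fml m P Omega) :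
  H0_derives m_gt0 p0 Gamma phi -> entails m_gt0 A Gamma phi.
Proof.
move=> der M a Ga; have [h [h_bij h_val]] := valuation_nominal M.
elim: der => {phi} [f /Ga //|f thm_f|f g _ fg _ fa].
  exact: (thm_sound h_bij h_val thm_f a).
exact: (theory_Imp (sat_boolean_theory M a) f g).1 fg fa.
Qed.

(** * Deduction theorem and maximal theories *)

Section Lindenbaum.
Variables (m : nat) (m_gt0 : 0 < m) (P : Type) (p0 : P) (Omega : finType).
Local Notation fml := (fml m P Omega).
Local Notation thm := (@H0_thm m m_gt0 P p0 Omega).
Local Notation derives := (@H0_derives m m_gt0 P p0 Omega).

Record complete_theory (D : fml -> Prop) : Prop := CompleteTheory {
  complete_boolean :> boolean_theory D;
  complete_thm : forall f, thm f -> D f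
}.

Lemma derives_sub (G1 G2 : fml -> Prop) f :
  (forall g, G1 g -> derives G2 g) -> derives G1 f -> derives G2 f.
Proof.
move=> G12; elim=> {f} [f /G12 //|f ?|f g _ IHfg _ IHf]; first exact: DerThm.
exact: DerMP IHfg IHf.
Qed.

Lemma derives_tautology G t sigma : tautology t -> derives G (psubst sigma t).
Proof. by move=> taut; apply/DerThm/ThmAx/AxTaut. Qed.

Local Notation PImp t u := (PNeg (PAnd t (PNeg u))).
(** The default [Atom p0] is never reached: each tautology below uses only variables within its
    list. *)
Let seq_subst (s : seq fml) n := nth (Atom p0) s n.

(** Holds because modus ponens is the only rule acting on hypotheses; the modal rules stay inside
    [thm] and are never traversed. *)
Lemma deduction (G : fml -> Prop) f g :
  derives (fun k => G k \/ k = f) g -> derives G (Imp f g).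
Proof.
have weaken k : derives G k -> derives G (Imp f k).
  apply: DerMP; pose t := PImp (PVar 0) (PImp (PVar 1) (PVar 0)).
  apply: (@derives_tautology _ t (seq_subst [:: k; f])) => v /=.
  by case: (v 0); case: (v 1).
elim=> {g} [g [Gg|->]|g thm_g|g k _ IHgk _ IHg].
- exact/weaken/DerHyp.
- apply: (@derives_tautology _ (PImp (PVar 0) (PVar 0)) (seq_subst [:: f])).
  by move=> v /=; case: (v 0).
- exact/weaken/DerThm.
- apply: DerMP IHg; apply: DerMP IHgk.
  pose t := PImp (PImp (PVar 0) (PImp (PVar 1) (PVar 2)))
                 (PImp (PImp (PVar 0) (PVar 1)) (PImp (PVar 0) (PVar 2))).
  apply: (@derives_tautology _ t (seq_subst [:: f; g; k])) => v /=.
  by case: (v 0); case: (v 1); case: (v 2).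
Qed.

(** A derivation uses finitely many members of the union, and at each modus ponens the larger of two
    sets of the chain serves both premises. The first alternative takes care of the empty chain. *)
Lemma derives_bigcup G (F : set (set fml)) f :
    total_on F subset ->
    derives (fun g => G g \/ (\bigcup_(X in F) X)%classic g) f ->
  derives G f \/ exists2 X, F X & derives (fun g => G g \/ X g) f.
Proof.
move=> F_total.
have left_sub X g : derives G g -> derives (fun k => G k \/ X k) g.
  by apply: derives_sub => k Gk; apply: DerHyp; left.
have right_sub (X Y : set fml) g : (X `<=` Y)%classic ->
    derives (fun k => G k \/ X k) g -> derives (fun k => G k \/ Y k) g.
  move=> XY; apply: derives_sub => k [Gk|/XY Yk]; apply: DerHyp; first by left.
  by right.
elim=> {f} [f [Gf|[X FX Xf]]|f thm_f|f g _ IHfg _ IHf].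
- by left; apply: DerHyp.
- by right; exists X => //; apply: DerHyp; right.
- by left; apply: DerThm.
case: IHfg IHf => [Dfg|[X FX Dfg]] [Df|[Y FY Df]].
- by left; apply: DerMP Df.
- by right; exists Y => //; apply: DerMP Df; apply: left_sub.
- by right; exists X => //; apply: DerMP Dfg _; apply: left_sub.
right; case: (F_total X Y FX FY) => XY.
- by exists Y => //; apply: DerMP Df; apply: right_sub Dfg.
- by exists X => //; apply: DerMP Dfg _; apply: right_sub Df.
Qed.

Lemma lindenbaum G phi : ~ derives G phi ->
  exists D, [/\ complete_theory D, forall f, G f -> D f & ~ D phi].
Proof.
move=> nGphi.
have [F subF F_total|X [nXphi maxX]] := @Zorn_bigcup fml
    (fun X => ~ derives (fun g => G g \/ X g) phi).
  by case/(derives_bigcup F_total) => [//|[X /subF nX /nX]].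
pose D := derives (fun g => G g \/ X g).
(* By maximality, adding a formula outside [D] makes [phi] derivable; the deduction theorem then
   applies. *)
have extend f : ~ D f -> D (Imp f phi).
  move=> nDf; apply: deduction; apply: contrapT => nder.
  apply: (maxX (fun k => X k \/ k = f)); last first.
    by apply: contra_not nder; apply: derives_sub => g Gg; apply: DerHyp;
       case: Gg => [|[]]; intuition.
  split=> [|sub]; first by left.
  by apply: nDf; apply: DerHyp; right; apply: sub; right.
have taut t s : tautology t -> D (psubst (seq_subst s) t).
  exact: derives_tautology.
exists D; split=> // [|f Gf]; last by apply: DerHyp; left.
split=> [|f thm_f]; last exact: DerThm.
split=> [f|f g].
- split=> [Dnf Df | nDf].
    apply: nXphi; apply: DerMP Df; apply: DerMP Dnf.
    apply: (taut (PImp (PNeg (PVar 0)) (PImp (PVar 0) (PVar 1))) [:: f; phi]).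
    by move=> v /=; case: (v 0).
  (* If both [f] and [Neg f] were missing, each would imply [phi] in [D], hence [phi] would be
     derivable. *)
  apply: contrapT => /extend Dnf; apply: nXphi.
  apply: DerMP Dnf; apply: DerMP (extend _ nDf).
  apply: (taut (PImp (PImp (PVar 0) (PVar 1))
                 (PImp (PImp (PNeg (PVar 0)) (PVar 1)) (PVar 1))) [:: f; phi]).
  by move=> v /=; case: (v 0); case: (v 1).
- split=> [Dfg|[Df Dg]].
    split; apply: DerMP Dfg.
      apply: (taut (PImp (PAnd (PVar 0) (PVar 1)) (PVar 0)) [:: f; g]).
      by move=> v /=; case: (v 0); case: (v 1).
    apply: (taut (PImp (PAnd (PVar 0) (PVar 1)) (PVar 1)) [:: f; g]).
    by move=> v /=; case: (v 0); case: (v 1).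
  apply: DerMP Dg; apply: DerMP Df.
  apply: (taut (PImp (PVar 0) (PImp (PVar 1) (PAnd (PVar 0) (PVar 1))))
               [:: f; g]).
  by move=> v /=; case: (v 0); case: (v 1).
Qed.

Lemma complete_At D i :
  complete_theory D -> complete_theory (fun f => D (At i f)).
Proof.
move=> cD; have D_ax f : H0_axiom m_gt0 p0 f -> D f.
  by move=> ?; apply/(complete_thm cD)/ThmAx.
split=> [|f thm_f]; last exact/(complete_thm cD)/ThmGen.
split=> [f|f g].
  by rewrite -(theory_Neg cD); symmetry; apply/(theory_Iff cD)/D_ax/AxSelf.
by rewrite -(theory_And cD); apply/(theory_Iff cD)/D_ax/AxConjAt.
Qed.

(** The box unfolds to a diamond over a double negation. The Boolean clauses do not reach below a
    diamond, so the replacement rule removes it. *)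
Lemma complete_Box D r f :
  complete_theory D -> D (Box r (Neg f)) <-> ~ D (Dia r f).
Proof.
move=> cD; rewrite (theory_Neg cD).
suff /(theory_Iff cD) E : D (Iff (Dia r (Neg (Neg f))) (Dia r f)) by rewrite E.
apply/(complete_thm cD)/(ThmRepl (CDia r (CHole m P Omega)))/ThmAx.
pose t := PVar 0; pose u := PNeg (PNeg t).
apply: (@AxTaut _ _ _ _ _ (PAnd (PImp u t) (PImp t u)) (seq_subst [:: f])).
by move=> v /=; case: (v 0).
Qed.

End Lindenbaum.

(** * The canonical network and its truth lemma *)

Section CanonicalNetwork.
Variables (m : nat) (m_gt0 : 0 < m) (P : Type) (p0 : P) (Omega A : finType).
Local Notation fml := (fml m P Omega).
Variable D : fml -> Prop.
Hypothesis cD : complete_theory m_gt0 p0 D.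
Variables (h : Omega -> A) (g : A -> Omega).
Hypotheses (hK : cancel h g) (gK : cancel g h).

Let cDAt i : complete_theory m_gt0 p0 (fun f => D (At i f)) :=
  complete_At i cD.
Let D_ax f : H0_axiom m_gt0 p0 f -> D f.
Proof. by move=> ?; apply/(complete_thm cD)/ThmAx. Qed.
Let DAt_ax i f : H0_axiom m_gt0 p0 f -> D (At i f).
Proof. by move=> ?; apply/(complete_thm (cDAt i))/ThmAx. Qed.

Lemma canonical_Nom i j : D (At i (Nom j)) <-> i = j.
Proof.
split=> [Dij|<-]; last exact/D_ax/AxRefAt.
apply: contrapT => ij; have := D_ax (AxDist m_gt0 p0 ij).
by move/(theory_Neg (cDAt i)).
Qed.

(** The existence lemma: by (Paste) a nominal witnesses each diamond, so the single theory [D]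
    describes all points. *)
Lemma canonical_Dia i r f :
  D (At i (Dia r f)) <-> exists j, D (At i (Dia r (Nom j))) /\ D (At j f).
Proof.
rewrite ((theory_Iff cD _ _).1 (D_ax (AxPaste _ _ r i f))) (theory_BigOr p0 cD).
by split=> -[j /(theory_And cD) ?]; exists j.
Qed.

(** By contraposition: the box axiom is applied to a negated nominal, as also for monotonicity and
    the triangle law. *)
Lemma canonical_refl r i : D (At i (Dia r (Nom i))).
Proof.
apply: contrapT => /(complete_Box _ _ (cDAt i)).
have /(theory_Imp (cDAt i)) T := DAt_ax i (AxT m_gt0 p0 r (Neg (Nom i))).
by move/T/(theory_Neg (cDAt i)); apply; apply/canonical_Nom.
Qed.

(** (B) on the nominal [i] puts [Box r (Dia r (Nom i))] at [i]; the step to [j] would refute it if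
    [j] failed to see [i]. *)
Lemma canonical_sym r i j :
  D (At i (Dia r (Nom j))) -> D (At j (Dia r (Nom i))).
Proof.
move=> Dij; apply: contrapT => /(theory_Neg (cDAt j)) nDji.
have /(theory_Imp (cDAt i)) B := DAt_ax i (AxB m_gt0 p0 r (Nom i)).
have /(theory_Neg (cDAt i)) := B ((canonical_Nom i i).2 erefl); apply.
by apply/canonical_Dia; exists j.
Qed.

Lemma canonical_mono (r s : grid m) i j : (gval r <= gval s)%R ->
  D (At i (Dia r (Nom j))) -> D (At i (Dia s (Nom j))).
Proof.
move=> rs Dij; apply: contrapT => /(complete_Box _ _ (cDAt i)).
have /(theory_Imp (cDAt i)) Mon := DAt_ax i (AxMon m_gt0 p0 (Neg (Nom j)) rs).
by move/Mon/(complete_Box _ _ (cDAt i)).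
Qed.

(** Otherwise (Tri) would put [Box r (Box s (Neg (Nom k)))] at [i], which the path through [j]
    refutes. *)
Lemma canonical_tri r s i j k :
  D (At i (Dia r (Nom j))) -> D (At j (Dia s (Nom k))) ->
  D (At i (Dia (oplus r s) (Nom k))).
Proof.
move=> Dij Djk; apply: contrapT => /(complete_Box _ _ (cDAt i)).
have /(theory_Imp (cDAt i)) Tri := DAt_ax i (AxTri m_gt0 p0 r s (Neg (Nom k))).
move/Tri/(theory_Neg (cDAt i)); apply; apply/canonical_Dia; exists j.
split=> //; apply/(theory_Neg (cDAt j)) => /(complete_Box _ _ (cDAt j)).
exact.
Qed.

Definition canonical_sim r : rel A :=
  fun a b => `[< D (At (g a) (Dia r (Nom (g b)))) >].

(** Nominals are read off [h] rather than [D]; [canonical_Nom] shows that both agree. *)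
Definition canonical_valuation (x : P + Omega) : {set A} :=
  match x with
  | inl p => [set a | `[< D (At (g a) (Atom p)) >]]
  | inr i => [set h i]
  end.

Program Definition canonical_network : network m_gt0 P Omega A :=
  @Network m m_gt0 P Omega A canonical_sim canonical_valuation _ _ _ _ _ _.
Next Obligation. by exists h; split=> //; exists g. Qed.
Next Obligation. exact/asboolP/canonical_refl. Qed.
Next Obligation. by split=> /asboolP ?; apply/asboolP/canonical_sym. Qed.
Next Obligation. exact/asboolP/D_ax/AxBd. Qed.
Next Obligation. by apply/asboolP; apply: canonical_mono H _; apply/asboolP. Qed.
Next Obligation.
by apply/asboolP; apply: (@canonical_tri _ _ _ (g b)); apply/asboolP.
Qed.

Lemma canonical_truth f a : sat canonical_network f a <-> D (At (g a) f).
Proof.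
have val_h i : valuation canonical_network (inr i) = [set h i] by [].
elim: f a => [p|i|f IHf|f1 IH1 f2 IH2|r f IHf|i f IHf] a.
- by rewrite /= inE; split=> /asboolP.
- by rewrite (sat_Nom val_h) canonical_Nom; split=> [->|<-].
- by rewrite (theory_Neg (cDAt _)) -IHf; split=> /negP.
- by rewrite (theory_And (cDAt _)) -IH1 -IH2; split=> /andP.
- rewrite sat_Dia canonical_Dia; split=> [[b [/asboolP ab /IHf fb]]|[j [aj fj]]].
    by exists (g b).
  exists (h j); split; last by apply/IHf; rewrite hK.
  by apply/asboolP; rewrite hK.
(* (Agree) absorbs the outer [At (g a)]. *)
- rewrite (sat_At val_h) IHf hK; symmetry.
  exact/(theory_Iff cD)/D_ax/AxAgree.
Qed.

Lemma canonical_agent : exists a, forall f, sat canonical_network f a <-> D f.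
Proof.
have /(theory_BigOr p0 cD)[i Di] := D_ax (AxName m_gt0 p0 Omega).
exists (h i) => f; rewrite canonical_truth hK; symmetry.
have /(theory_Imp cD) Loc := D_ax (AxLocality m_gt0 p0 i f).
exact/(theory_Iff cD)/Loc.
Qed.

End CanonicalNetwork.

Lemma completeness (m : nat) (m_gt0 : 0 < m) (P : Type) (p0 : P)
    (Omega A : finType) (Gamma : fml m P Omega -> Prop) (phi : fml m P Omega) :
    #|Omega| = #|A| ->
  entails m_gt0 A Gamma phi -> H0_derives m_gt0 p0 Gamma phi.
Proof.
move=> card_OA ent; apply: contrapT => nder.
have [D [cD GD nDphi]] := lindenbaum nder.
(* Entailment concerns networks on the given [A], so the canonical network is carried there by
   matching the enumerations of [Omega] and [A]. *)
pose h (i : Omega) : A := enum_val (cast_ord card_OA (enum_rank i)).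
have [g hK gK] : bijective h.
  apply: inj_card_bij; last by rewrite card_OA.
  by move=> i j /enum_val_inj/cast_ord_inj/enum_rank_inj.
have [a sat_a] := canonical_agent cD hK gK.
by apply/nDphi/sat_a/ent => f /GD /sat_a.
Qed.

Theorem theorem2p4 (m : nat) (m_gt0 : 0 < m)
    (A : finType) (A_nonempty : 0 < #|A|)
    (P : Type) (p0 : P)
    (Omega : finType) (card_Omega : #|Omega| = #|A|)
    (Gamma : fml m P Omega -> Prop) (phi : fml m P Omega) :
  H0_derives m_gt0 p0 Gamma phi <-> entails m_gt0 A Gamma phi.
Proof.
split; first exact: soundness.
exact: completeness.
Qed.
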